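(* Let $N$ be a topologically finite, orientable 3-manifold with an ideal triangulation $\mathcal{T}$, and let $\xi=(\xi_e)_{e\in N^{(1)}}$ with $\xi_e\in S^1=\{z\in\mathbb{C}: |z|=1\}$ for each edge $e$. If there is a solution to the $\xi$-hyperbolic gluing equations for $N$, then all edges in the induced ideal triangulation of the space $N_o$ associated with the solution are essential.
   Context: Ideal triangulations. $N$ is connected. An ideal triangulation $\mathcal{T}$ of $N$ consists of a disjoint union $\widetilde{\Delta}=\bigcup_{k=1}^n\widetilde{\Delta}_k$ of standard Euclidean 3-simplices and a collection $\Phi$ of Euclidean isometries (face pairings) identifying the 2-faces of $\widetilde\Delta$ in pairs, such that $N=(\widetilde{\Delta}\setminus\widetilde{\Delta}^{(0)})/\Phi$. $N$ is oriented and all 3-simplices carry the induced orientations. Put $P=\widetilde\Delta/\Phi$, so $N=P\setminus P^{(0)}$; $P^{(k)}$ is the set of (possibly singular) $k$-simplices of $P$, with $P^{(3)}=\{\sigma_1,\dots,\sigma_n\}$ and $N^{(1)}=P^{(1)}=\{e_1,\dots,e_m\}$. Let $C=P\setminus E$, where $E$ is an open regular neighbourhood of $P^{(0)}$ whose boundary meets each 3-simplex in exactly four disjoint normal triangles, one at each corner. $\xi$-hyperbolic gluing equations. Fix the following labelling of the edges of an oriented 3-simplex with vertices $v_0,v_1,v_2,v_3$, ordered compatibly with the orientation: $v_0v_1,v_2v_3$ are labelled $z$; $v_1v_2,v_0v_3$ are labelled $z'$; $v_1v_3,v_0v_2$ are labelled $z''$. For each $\sigma_i$ fix an orientation-preserving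 simplicial map $f_i:\Delta^3\to\sigma_i$ from the labelled standard simplex, with variables $z_i,z_i',z_i''\in\mathbb{C}\setminus\{0\}$. Let $a_{ij},a'_{ij},a''_{ij}$ be the number of edges in $f_i^{-1}(e_j)$ with label $z,z',z''$ respectively. A solution to the $\xi$-hyperbolic gluing equations is an assignment of values satisfying the parameter relations $z_i(1-z_i'')=1$, $z_i'(1-z_i)=1$, $z_i''(1-z_i')=1$ for all $i$ and $\prod_{i=1}^n z_i^{a_{ij}}(z_i')^{a'_{ij}}(z_i'')^{a''_{ij}}=\xi_{e_j}$ for all $j$. The handlebody and $\widetilde H^*$. Let $H=C\setminus\nu(P^{(1)})$, where $\nu(P^{(1)})$ is a union of pairwise disjoint open tubular neighbourhoods of the edges. $H$ is a handlebody, decomposed into tetrahedra truncated at vertices and edges. $\partial H$ is the union of the vertex boundary $\partial H\cap\partial C$ and the edge boundary (the closure of $\partial H\setminus\partial C$), the latter consisting of one annulus for each edge of $P$; fix an identification of each annulus with $S^1\times[0,1]$, the $[0,1]$ direction being parallel to the edge. Let $\widetilde H$ be the universal cover of $H$ with the lifted decomposition. Form $\widetilde H^*$ from $\widetilde H$ by first collapsing each edge boundary component $\mathbb{R}\times[0,1]$ to $[0,1]$ by projection, and then collapsing each component of the boundary of the resulting space to a point. $\widetilde H^*$ is a union of tetrahedra glued along faces, $\pi_1(H)$ acts simplicially on it, and there is a natural quotient map $\widetilde H^*\to P$. The representation. Given a solution, lift the shape parameters to the tetrahedra of $\widetilde H^*$. Starting with one tetrahedron and an ideal hyperbolic tetrahedron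 of its shape and developing across faces (the tetrahedra of $\widetilde H^*$ are arranged in a tree), one obtains a pseudo-developing map $D:\widetilde H^*\to\overline{\mathbb{H}}^3=\mathbb{H}^3\cup\partial\mathbb{H}^3$, under which the vertices of each tetrahedron are sent to four distinct points of $\partial\mathbb{H}^3=\mathbb{C}\cup\{\infty\}$ such that, for vertices $v_0,\dots,v_3$ ordered compatibly with the orientation, the element of $PSL_2(\mathbb{C})$ taking the images of $v_0,v_1,v_2$ to $0,\infty,1$ takes the image of $v_3$ to the shape parameter (label) of the edge $v_0v_1$. The representation $\rho:\pi_1(H)\to PSL_2(\mathbb{C})$ is defined by letting $\rho(\gamma)$ be the unique element taking the $D$-images of the vertices of a triangle $\tau_0$ of $\widetilde H^*$ to the $D$-images of the corresponding vertices of $\gamma\cdot\tau_0$ (independent of $\tau_0$). The space $N_o$. Put $P_o=\widetilde H^*/\ker(\rho)$ and $N_o=P_o\setminus P_o^{(0)}$, with the induced decompositions into (ideal) simplices. (Here $o=(o(\xi_e))_e$ records the orders $o(\xi_e)\in\mathbb{N}\cup\{\infty\}$ of the $\xi_e$; edges of $N_o$ over $e$ have degree $o(\xi_e)\deg(e)$, possibly infinite, in which case points on the edge are not manifold points.) Essential edges. Let $C_o$ be the complement in $P_o$ of an open neighbourhood of $P_o^{(0)}$ obtained by truncating all tetrahedra at their vertices; $\partial C_o$ is the union of the truncation triangles. An edge $e$ of $N_o$ (equivalently of $P_o$) is essential if the arc $e\cap C_o$ is not homotopic, by a homotopy in $C_o$ fixing endpoints, to an arc in $\partial C_o$. *)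

(* Defs.v *)
From HB Require Import structures.
From Stdlib Require Import Relation_Operators.
From mathcomp Require Import all_boot all_order all_algebra all_fingroup.
From mathcomp Require Import generic_quotient.
From mathcomp Require Import all_classical all_reals all_analysis.
From mathcomp Require Import complex.

Set Implicit Arguments.
Unset Strict Implicit.
Unset Printing Implicit Defensive.

Import Order.TTheory GRing.Theory Num.Theory.
Import numFieldNormedType.Exports.
Local Open Scope classical_set_scope.
Local Open Scope ring_scope.
Local Open Scope complex_scope.
Local Open Scope quotient_scope.

Section Quotient.
Context {T : choiceType} (r : T -> T -> Prop).

Definition gen_rel (x y : T) : bool := `[< clos_refl_sym_trans T r x y >].

Lemma gen_rel_refl : reflexive gen_rel.
Proof. by move=> x; apply/asboolP; apply: rst_refl. Qed.

Lemma gen_rel_sym : symmetric gen_rel.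
Proof.
by move=> x y; apply/idP/idP => /asboolP h; apply/asboolP; apply: rst_sym.
Qed.

Lemma gen_rel_trans : transitive gen_rel.
Proof.
move=> y x z /asboolP h1 /asboolP h2; apply/asboolP.
exact: rst_trans h1 h2.
Qed.

Definition gen_equiv : equiv_rel T :=
  EquivRel gen_rel gen_rel_refl gen_rel_sym gen_rel_trans.

End Quotient.

(** The quotient of the space [T] by the equivalence relation generated by [r],
    with the quotient topology. *)
Definition quot (T : topologicalType) (r : T -> T -> Prop) : topologicalType :=
  quotient_topology {eq_quot (gen_equiv r)}.

Definition quot_pi (T : topologicalType) (r : T -> T -> Prop) (x : T) : quot r :=
  \pi_({eq_quot (gen_equiv r)}) x.

Section Homotopy.
Context (R : realType) (Y : topologicalType).

Definition path_in (A : set Y) (f : R -> Y) : Prop :=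
  {within `[0, 1], continuous f} /\ (forall s, 0 <= s <= 1 -> A (f s)).

(** [f] and [g] are homotopic relative to their endpoints, within [A]; the
    second coordinate of [F] is the time of the homotopy. *)
Definition homotopic_in (A : set Y) (f g : R -> Y) : Prop :=
  exists F : R * R -> Y,
    [/\ {within `[0, 1] `*` `[0, 1], continuous F},
        (forall s t, 0 <= s <= 1 -> 0 <= t <= 1 -> A (F (s, t))),
        (forall s, 0 <= s <= 1 -> F (s, 0) = f s /\ F (s, 1) = g s) &
        (forall t, 0 <= t <= 1 -> F (0, t) = f 0 /\ F (1, t) = f 1)].

Definition simply_connected : Prop :=
  [/\ exists x : Y, True,
      (forall x y : Y, exists f, [/\ path_in setT f, f 0 = x & f 1 = y]) &
      (forall f, path_in setT f -> f 0 = f 1 ->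
         homotopic_in setT f (fun=> f 0))].

End Homotopy.

Definition covering (X Y : topologicalType) (A : set Y) (p : X -> Y) : Prop :=
  [/\ continuous p, range p = A &
      forall y, A y -> exists U : set Y, [/\ open U, U y &
        exists (I : Type) (V : I -> set X),
          [/\ (forall i, open (V i)), trivIset setT V,
              p @^-1` U = \bigcup_i V i &
              forall i, set_bij (V i) (U `&` A) p /\
                (forall W, open W -> W `<=` V i ->
                   exists2 W', open W' & p @` W = W' `&` A)]]].

Definition universal_covering (R : realType) (X Y : topologicalType)
    (A : set Y) (p : X -> Y) : Prop :=
  covering A p /\ simply_connected R X.
Arguments universal_covering R {X Y}.

(** The vertices of every tetrahedron are numbered [0, 1, 2, 3] compatibly with
    the orientation; this numbering is the fixed orientation preserving map from
    the labelled standard simplex.  If [glue T i f = (j, g)], the face of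
    tetrahedron [i] opposite to its vertex [f] is identified with the face of
    tetrahedron [j] opposite to [g f], the vertex [k != f] going to [g k].  The
    isometry of faces determines [g], and as the vertices are numbered compatibly
    with the orientation it reverses the induced orientations of the faces
    exactly when [g] is odd. *)
Record ideal_triangulation (n : nat) := IdealTriangulation {
  glue : 'I_n -> 'I_4 -> 'I_n * 'S_4;
  glue_inv : forall i f,
    glue (glue i f).1 ((glue i f).2 f) = (i, ((glue i f).2)^-1%g);
  glue_free : forall i f, ((glue i f).1, (glue i f).2 f) != (i, f);
  glue_odd : forall i f, odd_perm (glue i f).2;
  tet_pos : (0 < n)%N;
  glue_connected : forall i j,
    connect (fun a b : 'I_n => [exists f, (glue a f).1 == b]) i j
}.

(** An edge of the disjoint union of the [n] simplices is a pair of a simplex and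
    a two-element set of its vertices. *)
Definition model_edges (n : nat) : {set 'I_n * {set 'I_4}} :=
  [set a : 'I_n * {set 'I_4} | #|a.2| == 2]%SET.

Definition edge_adj n (T : ideal_triangulation n) : rel ('I_n * {set 'I_4}) :=
  fun a b => [exists f, [&& f \notin a.2, (glue T a.1 f).1 == b.1 &
                            [set (glue T a.1 f).2 k | k in a.2]%SET == b.2]].

Definition edges n (T : ideal_triangulation n) : {set {set 'I_n * {set 'I_4}}} :=
  equivalence_partition (connect (edge_adj T)) (model_edges n).

Definition lab_z : {set {set 'I_4}} := [set [set 0; 1]; [set 2; 3]]%SET.
Definition lab_z' : {set {set 'I_4}} := [set [set 1; 2]; [set 0; 3]]%SET.
Definition lab_z'' : {set {set 'I_4}} := [set [set 1; 3]; [set 0; 2]]%SET.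

Record shapes (R : realType) (n : nat) := Shapes {
  sh_z : 'I_n -> R[i];
  sh_z' : 'I_n -> R[i];
  sh_z'' : 'I_n -> R[i]
}.

Definition edge_param (R : realType) n (z : shapes R n) (i : 'I_n)
    (a : {set 'I_4}) : R[i] :=
  if a \in lab_z then sh_z z i
  else if a \in lab_z' then sh_z' z i
  else sh_z'' z i.

Definition incidence n (lab : {set {set 'I_4}}) (i : 'I_n)
    (e : {set 'I_n * {set 'I_4}}) : nat :=
  #|[set a in lab | (i, a) \in e]%SET|.

Definition gluing_solution (R : realType) n (T : ideal_triangulation n)
    (xi : {set 'I_n * {set 'I_4}} -> R[i]) (z : shapes R n) : Prop :=
  [/\ (forall i, [/\ sh_z z i != 0, sh_z' z i != 0 & sh_z'' z i != 0]),
      (forall i, [/\ sh_z z i * (1 - sh_z'' z i) = 1,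
                     sh_z' z i * (1 - sh_z z i) = 1 &
                     sh_z'' z i * (1 - sh_z' z i) = 1]) &
      forall e, e \in edges T ->
        \prod_(i < n) (sh_z z i ^+ incidence lab_z i e *
                       sh_z' z i ^+ incidence lab_z' i e *
                       sh_z'' z i ^+ incidence lab_z'' i e) = xi e].

Section Simplex.
Context (R : realType).

Definition simplex_set : set 'rV[R]_4 :=
  [set x | (forall k, 0 <= x 0 k) /\ \sum_k x 0 k = 1].

Definition simplex : topologicalType := set_type simplex_set.

Definition bary (x : simplex) (k : 'I_4) : R := (set_val x : 'rV[R]_4) 0 k.

Lemma vertex_subproof (k : 'I_4) : delta_mx 0 k \in simplex_set.
Proof.
rewrite inE; split=> [l|]; first by rewrite mxE ler0n.
rewrite (bigD1 k)//= big1 => [|l lk]; first by rewrite mxE !eqxx addr0.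
by rewrite mxE (negbTE lk) andbF.
Qed.

Definition vertex (k : 'I_4) : simplex := SigSub (vertex_subproof k).

(** For [s] in [[0, 1]] and [k != l]: the part of the edge from [k] to [l] where
    both barycentric coordinates are at most 3/4.  The default value of [insubd]
    is not used for such [s]. *)
Definition trunc_edge (k l : 'I_4) (s : R) : simplex :=
  insubd (vertex k)
    (\row_j ((3/4 - s/2) *+ (j == k) + (1/4 + s/2) *+ (j == l))).

(** A simplex truncated at its vertices and then along its edges.  The removed
    neighbourhoods of distinct edges are disjoint: if the sums of the coordinates
    exceed 9/10 on two edges, these have a common vertex, whose coordinate then
    exceeds 8/10, which the first truncation excludes. *)
Definition trunc_set : set simplex :=
  [set x | (forall k, bary x k <= 3/4) /\
           (forall k l, k != l -> bary x k + bary x l <= 9/10)].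

Definition trunc_simplex : topologicalType := set_type trunc_set.

End Simplex.

Section Complex.
Context (R : realType) (I : Type) (Q : Type) (pt : I -> simplex R -> Q).

Definition cx_vertices : set Q :=
  [set q | exists i k, q = pt i (vertex R k)].

Definition cx_open_edge (i : I) (k l : 'I_4) : set Q :=
  [set pt i x | x in [set x | [/\ bary x k + bary x l = 1,
                                  0 < bary x k & 0 < bary x l]]].

Definition cx_open_edges : set (set Q) :=
  [set e | exists i k l, k != l /\ e = cx_open_edge i k l].

Definition cx_cusps : set Q :=
  [set q | exists i x, q = pt i x /\ exists k, 3/4 < bary x k].

Definition cx_core : set Q := ~` cx_cusps.

Definition cx_core_bd : set Q :=
  [set q | exists i x, q = pt i x /\ exists k, bary x k = 3/4].

End Complex.

(** The space obtained from the disjoint union of copies of the standard simplex,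
    indexed by [I], by face identifications; [adj i f j g] means that the face of
    [i] opposite to [f] is glued to the face of [j] opposite to [g f], the vertex
    [k != f] going to [g k]. *)
Section Realization.
Context (R : realType) (I : choiceType).
Context (adj : I -> 'I_4 -> I -> 'S_4 -> Prop).

Definition simplices : topologicalType := {_ : I & simplex R}.

Definition face_rel (a b : simplices) : Prop :=
  exists f g, [/\ adj (projT1 a) f (projT1 b) g,
    bary (projT2 a) f = 0 &
    forall k, bary (projT2 b) (g k) = bary (projT2 a) k].

Definition realization : topologicalType := quot face_rel.

Definition real_pt (i : I) (x : simplex R) : realization :=
  quot_pi face_rel (existT (fun _ : I => (simplex R : Type)) i x).

End Realization.

Section Handlebody.
Context (R : realType) (n : nat) (T : ideal_triangulation n).

Definition tri_adj (i : 'I_n) (f : 'I_4) (j : 'I_n) (g : 'S_4) : Prop :=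
  glue T i f = (j, g).

Definition P_space : topologicalType := realization R tri_adj.

Definition P_pt : 'I_n -> simplex R -> P_space := @real_pt R _ tri_adj.

Definition edge_tubes : set P_space :=
  [set q | exists i x, q = P_pt i x /\
     exists k l, k != l /\ 9/10 < bary x k + bary x l].

Definition handlebody : set P_space := cx_core P_pt `\` edge_tubes.

End Handlebody.
Arguments handlebody R {n} T.

Section UniversalCover.
Context (R : realType) (n : nat) (T : ideal_triangulation n).
Context (X : topologicalType) (p : X -> P_space R T).

(** The pieces of the lifted decomposition of [X]: a truncated simplex is simply
    connected, hence its map to [H] lifts, and the pieces over it correspond to
    the lifts. *)
Record lifted_tet := LiftedTet {
  lt_base : 'I_n;
  lt_map : trunc_simplex R -> X;
  lt_cont : continuous lt_map;
  lt_lift : forall x, p (lt_map x) = P_pt T lt_base (set_val x)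
}.

HB.instance Definition _ := gen_eqMixin lifted_tet.
HB.instance Definition _ := gen_choiceMixin lifted_tet.

Definition lift_adj (t : lifted_tet) (f : 'I_4) (t' : lifted_tet) (g : 'S_4) :
    Prop :=
  tri_adj T (lt_base t) f (lt_base t') g /\
  forall x y : trunc_simplex R,
    bary (set_val x) f = 0 ->
    (forall k, bary (set_val y) (g k) = bary (set_val x) k) ->
    lt_map t' y = lt_map t x.

(** The space [X] is the union of its pieces, adjacent ones meeting along truncated
    faces.  Projecting the boundary strips of [X] over the edges to intervals, and then
    collapsing the boundary components of the result to points, turns each
    truncated piece back into a simplex and leaves the identifications along
    faces. *)
Definition Hstar : topologicalType := realization R lift_adj.

Definition Hstar_pt : lifted_tet -> simplex R -> Hstar :=
  @real_pt R _ lift_adj.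

(** The deck transformation group of the universal cover, that is, the
    fundamental group of [H]. *)
Definition deck : Type :=
  {h : X -> X | [/\ continuous h, (forall x, p (h x) = p x) &
     exists h', [/\ continuous h', cancel h h' & cancel h' h]]}.

Lemma deck_cont (h : deck) (t : lifted_tet) : continuous (sval h \o lt_map t).
Proof.
case: h => h [hc _ _] /= x.
by apply: continuous_comp; [exact: lt_cont|exact: hc].
Qed.

Lemma deck_lift (h : deck) (t : lifted_tet) x :
  p ((sval h \o lt_map t) x) = P_pt T (lt_base t) (set_val x).
Proof. by case: h => h [_ hp _] /=; rewrite hp lt_lift. Qed.

Definition deck_act (h : deck) (t : lifted_tet) : lifted_tet :=
  LiftedTet (@deck_cont h t) (@deck_lift h t).

End UniversalCover.

Section PSL2.
Context (R : realType).

(** The boundary of hyperbolic space; [None] is the point at infinity. *)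
Definition sphere : Type := option R[i].

Definition SL2 : choiceType := {A : 'M[R[i]]_2 | \det A == 1}.

Definition eq_up_to_sign (A B : SL2) : bool :=
  (val A == val B) || (val A == - val B).

Lemma eq_up_to_sign_refl : reflexive eq_up_to_sign.
Proof. by move=> A; rewrite /eq_up_to_sign eqxx. Qed.

Lemma eq_up_to_sign_sym : symmetric eq_up_to_sign.
Proof.
by move=> A B; rewrite /eq_up_to_sign eq_sym -eqr_oppLR [- _ == _]eq_sym.
Qed.

Lemma eq_up_to_sign_trans : transitive eq_up_to_sign.
Proof.
move=> B A C; rewrite /eq_up_to_sign.
by move=> /orP[/eqP->|/eqP->] // /orP[/eqP->|/eqP->]; rewrite ?opprK eqxx ?orbT.
Qed.

Definition PSL2 : choiceType :=
  {eq_quot (EquivRel eq_up_to_sign eq_up_to_sign_refl eq_up_to_sign_sym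
                     eq_up_to_sign_trans)}.

Lemma SL2_one_subproof : \det (1%:M : 'M[R[i]]_2) == 1.
Proof. by rewrite det1. Qed.

Definition SL2_one : SL2 := exist _ 1%:M SL2_one_subproof.

Definition PSL2_one : PSL2 := \pi SL2_one.

Definition moebius_mx (A : 'M[R[i]]_2) (w : sphere) : sphere :=
  match w with
  | None => if A 1 0 == 0 then None else Some (A 0 0 / A 1 0)
  | Some w => if A 1 0 * w + A 1 1 == 0 then None
              else Some ((A 0 0 * w + A 0 1) / (A 1 0 * w + A 1 1))
  end.

(** Independent of the representing matrix, as opposite matrices act equally. *)
Definition moebius (g : PSL2) (w : sphere) : sphere := moebius_mx (val (repr g)) w.

End PSL2.

Section Developing.
Context (R : realType) (n : nat) (T : ideal_triangulation n).
Context (X : topologicalType) (p : X -> P_space R T).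

(** Only the values of a pseudo-developing map at the vertices of [Hstar p] are
    constrained and used.  The orderings of the vertices of [t] compatible with the
    orientation are the even permutations [s].  The four points [v k] are distinct
    for a solution [z] of the gluing equations, as the parameter relations exclude
    the values 0 and 1. *)
Definition developing (z : shapes R n) (D : Hstar p -> sphere R) : Prop :=
  forall (t : lifted_tet p) (s : 'S_4), ~~ odd_perm s ->
    let v k := D (Hstar_pt t (vertex R (s k))) in
    exists g : PSL2 R,
      [/\ moebius g (v 0) = Some 0, moebius g (v 1) = None,
          moebius g (v 2) = Some 1 &
          moebius g (v 3) =
            Some (edge_param z (lt_base t) [set s 0; s 1]%SET)].

(** Every vertex lies on a triangle, so it amounts to the same to ask this for the
    vertices of all triangles; the value of [rho h] is determined by three
    vertices. *)
Definition holonomy (D : Hstar p -> sphere R) (rho : deck p -> PSL2 R) : Prop :=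
  forall (h : deck p) (t : lifted_tet p) (k : 'I_4),
    moebius (rho h) (D (Hstar_pt t (vertex R k))) =
    D (Hstar_pt (deck_act h t) (vertex R k)).

Context (rho : deck p -> PSL2 R).

Definition ker_rel (q q' : Hstar p) : Prop :=
  exists h t x, [/\ rho h = PSL2_one R, q = Hstar_pt t x &
                    q' = Hstar_pt (deck_act h t) x].

Definition P_o : topologicalType := quot ker_rel.

Definition Po_pt (t : lifted_tet p) (x : simplex R) : P_o :=
  quot_pi ker_rel (Hstar_pt t x).

Definition N_o : set P_o := ~` cx_vertices Po_pt.

Definition No_edges : set (set P_o) := cx_open_edges Po_pt.

Definition C_o : set P_o := cx_core Po_pt.

Definition C_o_bd : set P_o := cx_core_bd Po_pt.

(** For any way of writing [e] as the image of an edge of a tetrahedron, the arc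
    in which [e] meets [C_o] is not homotopic in [C_o], relative to its
    endpoints, to a path in the boundary. *)
Definition essential (e : set P_o) : Prop :=
  forall t k l, k != l -> e = cx_open_edge Po_pt t k l ->
    ~ exists b : R -> P_o, path_in C_o_bd b /\
        homotopic_in C_o (fun s => Po_pt t (trunc_edge k l s)) b.

End Developing.
Arguments N_o {R n T X p} rho.
Arguments No_edges {R n T X p} rho.
Arguments C_o {R n T X p} rho.
Arguments C_o_bd {R n T X p} rho.

(* Main.v *)
(** Truncation triangles of [C_o] lying over one connected component of
    [C_o_bd] all cut off corners at the same vertex of [P_o].  As elements of the
    kernel of [rho] preserve the developing map on vertices, each component thus
    has a well-defined image point on the sphere.  If an arc of an edge were
    homotopic into [C_o_bd] relative to its endpoints, these would lie in one
    component and the two ends of the edge would develop to one point, although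
    the vertices of a tetrahedron develop to distinct points. *)
Require Import Defs.
From mathcomp Require Import all_boot all_order all_algebra all_fingroup.
From mathcomp Require Import generic_quotient.
From mathcomp Require Import all_classical all_reals all_analysis.
From mathcomp Require Import complex lra.
From Stdlib Require Import Relation_Operators.

Set Implicit Arguments.
Unset Strict Implicit.
Unset Printing Implicit Defensive.

Import Order.TTheory GRing.Theory Num.Theory.
Import numFieldNormedType.Exports.

Local Open Scope classical_set_scope.
Local Open Scope ring_scope.
Local Open Scope complex_scope.

(** [S] carries no topology, so continuity of the induced map is stated for one preimage at a time;
    it holds by definition of the quotient topology. *)
Lemma quot_lift (T : topologicalType) (r : T -> T -> Prop) (S : Type)
    (f : T -> S) : (forall x y, r x y -> f x = f y) ->
  exists2 F : quot r -> S, (forall x, F (quot_pi r x) = f x) &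
    forall A, open (f @^-1` A) -> open (F @^-1` A).
Proof.
move=> fr; have frE x y : clos_refl_sym_trans T r x y -> f x = f y.
  by elim=> [? ? /fr| |? ? _ ->|? ? ? _ -> _ ->].
pose F (q : quot r) := f (repr q).
have FE x : F (quot_pi r x) = f x.
  by apply/frE/asboolP/(@eqmodP _ (gen_equiv r)); exact: reprK.
exists F => // A; rewrite [in X in _ -> X]/open/= /quotient_open.
by congr open; apply/seteqP; split=> x /=; rewrite -FE.
Qed.

(** The fibres of [g] over values [Some w] are open and cover the connected image of [b], so the
    fibre through [b 0] is relatively open and closed there. *)
Lemma path_locally_constant (R : realType) (Y : topologicalType) (S : Type)
    (b : R -> Y) (g : Y -> option S) :
  {within `[0, 1], continuous b} ->
  (forall w, open (g @^-1` [set Some w])) ->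
  (forall s, 0 <= s <= 1 -> g (b s) <> None) ->
  g (b 0) = g (b 1).
Proof.
move=> bc go gN.
have /connected_continuous_connected/(_ bc) := @segment_connected R 0 1.
have m0 : `[0, 1]%classic (0 : R) by rewrite /= in_itv/= lexx ler01.
have m1 : `[0, 1]%classic (1 : R) by rewrite /= in_itv/= lexx ler01.
pose B := (b @` `[0, 1]) `&` (g @^-1` [set g (b 0)]).
move=> /(_ B) Bconn.
suff : B (b 1) by case.
rewrite Bconn; first by exists 1.
- by exists (b 0); split=> //; exists 0.
- exists (g @^-1` [set g (b 0)]) => //.
  have := gN 0; rewrite lexx ler01.
  by case: (g (b 0)) => [w _|/(_ isT)//]; exact: go.
(* Closedness: on the image of [b], this fibre is the complement of the union of the other
   fibres. *)
- exists (~` (\bigcup_(w in [set w | Some w <> g (b 0)]) g @^-1` [set Some w])).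
    by apply: open_closedC; apply: bigcup_open => w _; exact: go.
  apply/seteqP; split=> [y [yb /= gy]|y [[s s01 <-] /= gy]].
    by split=> // -[w /= wn]; rewrite gy => /esym.
  split; first by exists s.
  rewrite /=; apply: contrapT => ne.
  have : g (b s) <> None by apply: gN; rewrite /= in_itv/= in s01.
  case E : (g (b s)) => [w|]// _; apply: gy; exists w => //=.
  by rewrite -E.
Qed.

Section Bary.
Context (R : realType).
Implicit Types x : simplex R.

Lemma bary_continuous k : continuous (fun x => bary x k).
Proof.
move=> x; apply: (@continuous_comp _ _ _ (set_val : simplex R -> 'rV[R]_4)
  (fun M : 'rV[R]_4 => M 0 k)).
- exact: initial_continuous.
- exact: coord_continuous.
Qed.

Lemma bary_vertex k l : bary (vertex R k) l = (l == k)%:R.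
Proof. by rewrite /bary/= set_valE/= mxE eqxx. Qed.

Lemma bary_ge0 x k : 0 <= bary x k.
Proof. by case: x => x xP; case: (set_mem xP) => h _; exact: h. Qed.

Lemma bary_sum x : \sum_k bary x k = 1.
Proof. by case: x => x xP; case: (set_mem xP) => _. Qed.

Lemma bary_large_unique x k l : 1/2 < bary x k -> 1/2 < bary x l -> k = l.
Proof.
move=> hk hl; apply/eqP; apply: contraT => kl.
have := bary_sum x; rewrite (bigD1 k)//= (bigD1 l) 1?eq_sym//=.
have : 0 <= \sum_(i | (i != k) && (i != l)) bary x i.
  by apply: sumr_ge0 => i _; exact: bary_ge0.
lra.
Qed.

Lemma bary_trunc_edge (k l : 'I_4) (s : R) (j : 'I_4) : k != l -> 0 <= s <= 1 ->
  bary (trunc_edge k l s) j =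
    (3/4 - s/2) *+ (j == k) + (1/4 + s/2) *+ (j == l).
Proof.
move=> kl /andP[s0 s1]; rewrite /bary /trunc_edge set_valE insubdK; first by rewrite mxE.
rewrite inE; split=> [i|].
  rewrite mxE; apply: addr_ge0; apply: mulrn_wge0; lra.
under eq_bigr do rewrite mxE !mulrb.
by rewrite big_split/= -!big_mkcond/= !big_pred1_eq; lra.
Qed.

End Bary.

Lemma moebius1 (R : realType) (w : sphere R) : moebius (PSL2_one R) w = w.
Proof.
rewrite /moebius.
have : (repr (PSL2_one R) = SL2_one R %[mod PSL2 R])%qT by exact: reprK.
(* The chosen representative is the identity matrix or its negative; both act trivially. *)
move=> /eqmodP /orP[] /eqP ->; case: w => [w|] /=;
  rewrite !mxE/= ?mulr1n ?mulr0n ?oppr0 ?mul0r ?add0r ?addr0 ?eqxx//.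
  by rewrite oner_eq0 mul1r divr1.
by rewrite oppr_eq0 oner_eq0 mulNr mul1r invrN invr1 mulrN1 opprK.
Qed.

(** The values at 2 and 3 remain free, and exchanging them corrects the parity. *)
Lemma even_perm_prescribed (k l : 'I_4) : k != l ->
  exists s : 'S_4, [/\ ~~ odd_perm s, s 0 = k & s 1 = l].
Proof.
move=> kl.
pose l' := tperm 0 k 1; pose u : 'S_4 := (tperm 0 k * tperm l' l)%g.
have u0 : u 0 = k.
  rewrite permM tpermL tpermD//; last by rewrite eq_sym.
  by rewrite -[X in _ != X](tpermL 0 k) (inj_eq perm_inj).
have u1 : u 1 = l by rewrite permM tpermL.
have [uodd|ueven] := boolP (odd_perm u); last by exists u.
exists (tperm 2 3 * u)%g; split; first by rewrite odd_permM odd_tperm uodd.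
- by rewrite permM tpermD.
- by rewrite permM tpermD.
Qed.

Section Ends.
Context (R : realType) (n : nat) (T : ideal_triangulation n).
Context (X : topologicalType) (p : X -> P_space R T).
Context (D : Hstar p -> sphere R).

(** In an even ordering starting with [k], [l], one Moebius map sends the two images to 0 and
    infinity. *)
Lemma developing_inj (z : shapes R n) (t : lifted_tet p) (k l : 'I_4) :
  developing z D -> k != l ->
  D (Hstar_pt t (vertex R k)) <> D (Hstar_pt t (vertex R l)).
Proof.
move=> Ddev /even_perm_prescribed[s [seven <- <-]] Dkl.
by have [g []] := Ddev t s seven; rewrite Dkl => -> .
Qed.

(** The image on the sphere of the corner containing the point. At most one coordinate exceeds 1/2,
    so the corner is unique; as 1/2 < 3/4, these open corners contain the truncation triangles.
    [None] marks points in no corner. *)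
Definition end_image (a : simplices R (lifted_tet p)) : option (sphere R) :=
  omap (fun k => D (Hstar_pt (projT1 a) (vertex R k)))
    [pick k | 1/2 < bary (projT2 a) k].

Lemma end_imageE (t : lifted_tet p) (x : simplex R) k : 1/2 < bary x k ->
  end_image (existT _ t x) = Some (D (Hstar_pt t (vertex R k))).
Proof.
rewrite /end_image => hk; case: pickP => [l/= hl|/(_ k)/=]; last by rewrite hk.
by rewrite (bary_large_unique hl hk).
Qed.

Lemma end_image_None (t : lifted_tet p) (x : simplex R) :
  (forall k, ~~ (1/2 < bary x k)) -> end_image (existT _ t x) = None.
Proof.
by rewrite /end_image => h; case: pickP => //= l; rewrite (negbTE (h l)).
Qed.

Lemma Hstar_pt_glue (a b : simplices R (lifted_tet p)) :
  face_rel (@lift_adj _ _ _ _ p) a b ->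
  Hstar_pt (projT1 a) (projT2 a) = Hstar_pt (projT1 b) (projT2 b).
Proof.
case: a b => [t x] [t' y] h; apply/eqmodP/asboolP; exact: rst_step.
Qed.

(** A coordinate above 1/2 does not belong to the vertex opposite to the face, so the corner's
    vertex lies on the face and is glued along with it. *)
Lemma end_image_face a b :
  face_rel (@lift_adj _ _ _ _ p) a b -> end_image a = end_image b.
Proof.
case: a b => [t x] [t' y] /= [f [g [/= tt' xf xy]]].
have [[k hk]|hN] := pselect (exists k, 1/2 < bary x k).
  have kf : k != f by apply: contraTneq hk => ->; rewrite xf -leNgt; lra.
  rewrite (end_imageE t hk) (@end_imageE t' y (g k)) ?xy//.
  congr (Some (D _)).
  apply: (@Hstar_pt_glue (existT _ t (vertex R k)) (existT _ t' (vertex R (g k)))).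
  exists f, g; split=> //=; first by rewrite bary_vertex eq_sym (negbTE kf).
  by move=> l; rewrite !bary_vertex (inj_eq perm_inj).
rewrite !end_image_None// => k; apply/negP => h; apply: hN; last by exists k.
by exists ((g^-1)%g k); rewrite -xy permKV.
Qed.

Lemma end_image_open w : open (end_image @^-1` [set Some w]).
Proof.
apply/sigT_openP => t.
rewrite (_ : _ @^-1` _ = \bigcup_(k in [set k | D (Hstar_pt t (vertex R k)) = w])
    (fun x : simplex R => bary x k) @^-1` [set r | 1/2 < r]).
  apply: bigcup_open => k _.
  by apply: open_comp; [move=> x _; exact: bary_continuous|exact: open_gt].
apply/seteqP; split=> [x /=|x [k /= <- hk]]; last exact: end_imageE.
have [[k hk]|hN] := pselect (exists k, 1/2 < bary x k).
  by rewrite (end_imageE t hk) => -[Dw]; exists k.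
rewrite end_image_None// => k; apply/negP => h; apply: hN; by exists k.
Qed.

Context (rho : deck p -> PSL2 R) (rho_hol : holonomy D rho).

(** [end_image] descends through both quotients: face gluings identify vertices, and an element of
    the kernel of [rho] moves a vertex to one with the same image under [D]. *)
Lemma end_image_Po : exists2 E : P_o rho -> option (sphere R),
    (forall t x k, 1/2 < bary x k ->
       E (Po_pt rho t x) = Some (D (Hstar_pt t (vertex R k)))) &
    forall w, open (E @^-1` [set Some w]).
Proof.
have [F FE Fo] := quot_lift end_image_face.
have Finv q q' : ker_rel rho q q' -> F q = F q'.
  move=> [h [t [x [h1 -> ->]]]]; rewrite !FE.
  have [[k hk]|hN] := pselect (exists k, 1/2 < bary x k).
    by rewrite !(end_imageE _ hk) -rho_hol h1 moebius1.
  by rewrite !end_image_None// => k; apply/negP => hk; apply: hN; exists k.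
have [E EE Eo] := quot_lift Finv.
exists E => [t x k hk|w]; first by rewrite EE FE; exact: end_imageE.
by apply/Eo/Fo; exact: end_image_open.
Qed.

End Ends.

Theorem theorem3 (R : realType) (n : nat) (T : ideal_triangulation n)
    (xi : {set 'I_n * {set 'I_4}} -> R[i])
    (xi_unit : forall e, e \in edges T -> `|xi e| = 1)
    (z : shapes R n) (z_sol : gluing_solution T xi z)
    (X : topologicalType) (p : X -> P_space R T)
    (p_univ : universal_covering R (handlebody R T) p)
    (D : Hstar p -> sphere R) (D_dev : developing z D)
    (rho : deck p -> PSL2 R) (rho_hol : holonomy D rho)
    (e : set (P_o rho)) :
  No_edges rho e -> essential e.
Proof.
move=> _ t k l kl _ [b [[b_cont b_bd] [F [_ _ Fs Ft]]]].
have i0 : 0 <= (0 : R) <= 1 by rewrite lexx ler01.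
have i1 : 0 <= (1 : R) <= 1 by rewrite lexx ler01.
(* The homotopy fixes endpoints, so [b] begins and ends where the truncated edge does. *)
have [_ F01] := Fs 0 i0; have [_ F11] := Fs 1 i1.
have [Ft0 Ft1] := Ft 1 i1.
have b0 : b 0 = Po_pt rho t (trunc_edge k l 0) by rewrite -F01 Ft0.
have b1 : b 1 = Po_pt rho t (trunc_edge k l 1) by rewrite -F11 Ft1.
have [E EE Eo] := end_image_Po rho_hol.
have : E (b 0) = E (b 1).
  apply: (path_locally_constant b_cont Eo) => s /b_bd [t' [x [-> [j xj]]]].
  by rewrite (EE t' x j)// xj; lra.
(* The truncated edge starts with coordinate 3/4 at [k] and ends with 3/4 at [l]. *)
have k0 : 1/2 < bary (trunc_edge k l (0 : R)) k.
  by rewrite bary_trunc_edge// eqxx (negbTE kl) mulr1n mulr0n; lra.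
have l1 : 1/2 < bary (trunc_edge k l (1 : R)) l.
  by rewrite bary_trunc_edge// eqxx eq_sym (negbTE kl) mulr1n mulr0n; lra.
rewrite b0 b1 (EE _ _ _ k0) (EE _ _ _ l1) => -[].
exact: developing_inj D_dev kl.
Qed.
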